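(* Let $G$ be a finite undirected graph (loops allowed). Then every lamp configuration can be lit in the lamp game on $G$ if and only if the number of complete matchings in $G$ is odd.
   Context: The lamp game ($\sigma$-game) on an undirected graph $G$ with vertex set $V$ (no multiple edges; a vertex may or may not have a loop): every vertex has a button and a lamp. Initially all lamps are off. Pressing the button at a vertex $v$ toggles (on/off) the lamps at all vertices adjacent to $v$; the lamp at $v$ itself is toggled if and only if there is a loop at $v$. A lamp configuration is a subset $S\subseteq V$; it can be lit if some sequence of button presses, starting from all lamps off, results in exactly the lamps in $S$ being on. A complete matching in $G$ is a subset $M$ of the edges (loops included) such that every vertex is incident to exactly one edge in $M$; a loop at $v$ is a single edge incident to $v$ only, so a vertex may be covered by its own loop. *)

(* Defs.v *)
From mathcomp Require Import all_boot.

Set Implicit Arguments.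
Unset Strict Implicit.
Unset Printing Implicit Defensive.

(* A finite undirected graph without multiple edges, possibly with loops, is a
   symmetric relation [adj] on a finite type [V]; [adj v v] means that there is
   a loop at [v]. *)

(* A lamp configuration is the set of lamps that are on.  As [adj v v] holds iff
   there is a loop at [v], the lamp at [v] needs no separate case. *)
Definition press (V : finType) (adj : rel V) (S : {set V}) (v : V) : {set V} :=
  [set u | (u \in S) (+) adj v u].

Definition can_be_lit (V : finType) (adj : rel V) (S : {set V}) : Prop :=
  exists buttons : seq V, foldl (press adj) set0 buttons = S.

(* An edge is identified with its set of endpoints: a loop at [v] is the
   singleton [set v; v] = [set v], any other edge has two elements. *)
Definition edges (V : finType) (adj : rel V) : {set {set V}} :=
  [set [set p.1; p.2] | p : V * V & adj p.1 p.2].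

Definition complete_matching (V : finType) (adj : rel V) (M : {set {set V}}) :
  bool :=
  (M \subset edges adj) && [forall v, #|[set e in M | v \in e]| == 1].

(* Main.v *)
Require Import Defs.
From mathcomp Require Import all_boot.
From mathcomp Require Import all_fingroup all_algebra.

Set Implicit Arguments.
Unset Strict Implicit.
Unset Printing Implicit Defensive.

(** Let [A] be the adjacency matrix over F_2.  Pressing [v] adds row [v] of [A]
    to the lamp configuration, so every configuration can be lit iff [det A] is
    nonzero.  As signs vanish over F_2, the Leibniz formula makes [det A] the
    parity of the number of permutations [s] with [v] adjacent to [s v] for all
    [v].  Since [A] is symmetric, this set is stable under [s |-> s^-1], so only
    the involutions matter modulo 2, and these correspond to the complete
    matchings (fixed points being loops). *)

Import GRing.Theory.
Local Open Scope ring_scope.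

(** The points of [A] moved by [f] pair up as [x], [f x], so they contribute an even number. *)
Lemma odd_card_involution (T : finType) (A : {set T}) (f : T -> T) :
  involutive f -> {in A, forall x, f x \in A} ->
  odd #|A| = odd #|[set x in A | f x == x]|.
Proof.
move=> fK fA.
have fAE x : (f x \in A) = (x \in A).
  by apply/idP/idP => /fA //; rewrite fK.
rewrite -(cardsID [set x | f x == x] A) -setIdE oddD.
set B := A :\: _; suff -> : odd #|B| = false by rewrite addbF.
(* An arbitrary total order on [T] splits [B] into the points below their image and those above it;
   [f] exchanges the two halves. *)
pose r (x : T) : nat := enum_rank x.
rewrite -(cardsID [set x | (r x < r (f x))%N] B) oddD.
rewrite -(card_imset (B :&: _) (inv_inj fK)).
suff -> : f @: (B :&: [set x | (r x < r (f x))%N])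
          = B :\: [set x | (r x < r (f x))%N] by rewrite addbb.
apply/setP=> y; rewrite -{1}(fK y) mem_imset; last exact: inv_inj.
rewrite !inE fK fAE (eq_sym y) -leqNgt.
have [_|ney] /= := eqVneq (f y) y; first by rewrite andbF.
rewrite [RHS]andbC; congr (_ && _); rewrite [RHS]leq_eqVlt.
suff /negPf-> : (r (f y) != r y)%N by [].
by apply: contraNneq ney => /ord_inj /enum_rank_inj->.
Qed.

Lemma F2_natr_odd (n : nat) : n%:R = (odd n)%:R :> 'F_2.
Proof. by apply/val_inj; rewrite /= !val_Fp_nat // modn2; case: odd. Qed.

Lemma F2_natrb_neq0 (x : 'F_2) : x = (x != 0)%:R.
Proof. by case: x => [[|[|]]] // i; apply/val_inj. Qed.

Lemma F2_addb (a b : bool) : (a (+) b)%:R = a%:R + b%:R :> 'F_2.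
Proof. by case: a; case: b; apply/val_inj. Qed.

Lemma F2_sign (n : nat) : (-1) ^+ n = 1 :> 'F_2.
Proof. by rewrite (_ : -1 = 1) ?expr1n //; apply/val_inj. Qed.

Section LampGame.

Variables (V : finType) (adj : rel V).
Hypothesis adj_sym : symmetric adj.

Definition adjmx : 'M['F_2]_#|V| :=
  \matrix_(i, j) (adj (enum_val i) (enum_val j))%:R.

Definition lampv (S : {set V}) : 'rV['F_2]_#|V| :=
  \row_j (enum_val j \in S)%:R.

Definition adj_perms : {set {perm V}} := [set s : {perm V} | [forall v, adj v (s v)]].

Lemma lampv_inj : injective lampv.
Proof.
move=> S T /rowP eqST; apply/setP=> v; have := eqST (enum_rank v).
by rewrite !mxE enum_rankK; do 2 case: (v \in _).
Qed.

Lemma lampv_surj (x : 'rV_#|V|) : exists S, lampv S = x.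
Proof.
exists [set v | x 0 (enum_rank v) != 0]; apply/rowP=> j.
by rewrite mxE inE enum_valK -F2_natrb_neq0.
Qed.

Lemma lampv_presses (bs : seq V) (S : {set V}) :
  lampv (foldl (press adj) S bs)
  = lampv S + (\sum_(v <- bs) delta_mx 0 (enum_rank v)) *m adjmx.
Proof.
elim: bs S => [|v bs IH] S /=; first by rewrite big_nil mul0mx addr0.
rewrite IH big_cons mulmxDl addrA; congr (_ + _).
apply/rowP=> j; rewrite -rowE !mxE inE F2_addb.
by rewrite enum_rankK.
Qed.

(** By [lampv_presses] the configurations reachable from [set0] form the row space of [adjmx], which
    is everything iff [adjmx] has full rank. *)
Lemma all_lit_unitmx :
  (forall S, can_be_lit adj S) <-> adjmx \in unitmx.
Proof.
have lampv0 : lampv set0 = 0 by apply/rowP=> j; rewrite !mxE inE.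
split=> [lit|uA S].
  rewrite -row_full_unit -sub1mx; apply/row_subP=> i.
  have [S <-] := lampv_surj (row i 1%:M); have [bs <-] := lit S.
  by rewrite lampv_presses lampv0 add0r submxMl.
pose x := lampv S *m invmx adjmx.
(* Over F_2 a coefficient vector is its support: press each vertex of the support of [x] once. *)
exists (enum [set v | x 0 (enum_rank v) != 0]).
apply: lampv_inj; rewrite lampv_presses lampv0 add0r -[RHS](mulmxKV uA) -/x.
congr (_ *m _); rewrite [RHS]row_sum_delta big_enum /= big_mkcond /=.
rewrite (reindex (@enum_val _ V)) /=; last exact/onW_bij/enum_val_bij.
apply: eq_bigr => i _; rewrite inE enum_valK [in RHS](F2_natrb_neq0 (x 0 i)).
by case: ifP; rewrite ?scale1r ?scale0r.
Qed.

Lemma det_adjmx : \det adjmx = #|adj_perms|%:R.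
Proof.
have rank_inj (s : {perm V}) :
    injective (fun i : 'I_#|V| => enum_rank (s (enum_val i))).
  by move=> i j /enum_rank_inj /perm_inj /enum_val_inj.
have val_inj (t : 'S_#|V|) :
    injective (fun v : V => enum_val (t (enum_rank v))).
  by move=> u v /enum_val_inj /perm_inj /enum_rank_inj.
(* Conjugation by the enumeration of [V] turns the Leibniz sum into one over permutations of [V]. *)
rewrite /determinant (reindex (fun s => perm (rank_inj s))) /=; last first.
  exists (fun t => perm (val_inj t)) => s _; apply/permP=> i.
    by rewrite !permE enum_rankK enum_rankK.
  by rewrite !permE !enum_valK.
(* The product for [s] is 1 if [s] lies in [adj_perms]; otherwise it has a zero factor. *)
rewrite -[in RHS]sum1_card natr_sum [RHS]big_mkcond /=; apply: eq_bigr => s _.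
rewrite F2_sign mul1r inE; case: ifPn => [/forallP adj_s|].
  by apply: big1 => i _; rewrite mxE permE enum_rankK adj_s.
rewrite negb_forall => /existsP[v /negPf nadj].
by rewrite (bigD1 (enum_rank v)) //= mxE permE !enum_rankK nadj mul0r.
Qed.

Lemma set2_injr (v w w' : V) : [set v; w] = [set v; w'] -> w = w'.
Proof.
move=> e; have /set2P[wv|//] : w \in [set v; w'] by rewrite -e set22.
have /set2P[w'v|//] : w' \in [set v; w] by rewrite e set22.
by rewrite wv w'v.
Qed.

Lemma matching_eq (M : {set {set V}}) (e e' : {set V}) (v : V) :
  complete_matching adj M -> e \in M -> e' \in M -> v \in e -> v \in e' ->
  e = e'.
Proof.
case/andP=> _ /forallP /(_ v) /cards1P[e0 e0E] eM e'M ve ve'.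
have inE0 x : x \in M -> v \in x -> x = e0.
  by move=> xM vx; apply/set1P; rewrite -e0E inE xM.
by rewrite (inE0 e eM ve) (inE0 e' e'M ve').
Qed.

(** The edge may come from the ordered pair [(w, v)], hence the use of symmetry. *)
Lemma edges_set2 (v w : V) : [set v; w] \in edges adj -> adj v w.
Proof.
case/imsetP=> -[a b]; rewrite inE /= => ab e.
have : v \in [set a; b] by rewrite -e set21.
case/set2P=> va; first by move: e; rewrite va => /set2_injr->.
by move: e; rewrite va [RHS]setUC adj_sym => /set2_injr->.
Qed.

Definition perm_edges (s : {perm V}) : {set {set V}} :=
  [set [set v; s v] | v : V].

(** The default [v] is never reached for a complete matching, as [mate_edge] shows; a vertex covered
    by its loop is its own mate. *)
Definition mate (M : {set {set V}}) (v : V) : V :=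
  odflt v [pick w | [set v; w] \in M].

Section Mate.

Variable M : {set {set V}}.
Hypothesis matchM : complete_matching adj M.

Lemma mate_edge (v : V) : [set v; mate M v] \in M.
Proof.
rewrite /mate; case: pickP => //= none.
have /andP[/subsetP Medges /forallP/(_ v) /cards1P[e eE]] := matchM.
have : e \in [set e in M | v \in e] by rewrite eE set11.
rewrite inE => /andP[eM ve].
have /imsetP[[a b] _ /= e_ab] := Medges _ eM.
move: ve eM; rewrite e_ab => /set2P[] <- eM; first by have := none b; rewrite eM.
by have := none a; rewrite setUC eM.
Qed.

Lemma mate_unique (v w : V) : [set v; w] \in M -> w = mate M v.
Proof.
move=> vw; apply: (@set2_injr v).
by apply: (matching_eq matchM vw (mate_edge v) (v := v)); rewrite set21.
Qed.

Lemma mateK : involutive (mate M).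
Proof. by move=> v; rewrite -(@mate_unique _ v) // setUC mate_edge. Qed.

End Mate.

Lemma perm_edges_matching (s : {perm V}) :
  s \in adj_perms -> (s^-1)%g = s -> complete_matching adj (perm_edges s).
Proof.
rewrite inE => /forallP adj_s sV; have sK v : s (s v) = v by rewrite -{1}sV permK.
apply/andP; split.
  apply/subsetP=> _ /imsetP[v _ ->]; apply/imsetP.
  by exists (v, s v); rewrite // inE adj_s.
apply/forallP=> v; apply/cards1P; exists [set v; s v]; apply/setP=> e.
(* If [[set u; s u]] contains [v], then [u] is [v] or [s v], and the edge is the same since [s] is
   an involution. *)
rewrite !inE; apply/andP/eqP => [[/imsetP[u _ ->]]|->].
  by case/set2P=> ->; rewrite ?sK // setUC.
by split; [apply: imset_f | apply: set21].
Qed.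

(** [perm_edges] is a bijection from the involutions in [adj_perms] to the complete matchings, with
    inverse given by [mate]. *)
Lemma card_matchings :
  #|[set M | complete_matching adj M]|
  = #|[set s in adj_perms | (s^-1)%g == s]|.
Proof.
(* Injectivity: [s v] is recovered as the mate of [v] in [perm_edges s]. *)
rewrite -(card_in_imset (f := perm_edges)) => [|s t]; last first.
  rewrite !inE => /andP[adj_s /eqP sV] _ st; apply/permP=> v.
  have match_s : complete_matching adj (perm_edges s).
    by apply: perm_edges_matching; rewrite ?inE.
  rewrite (mate_unique match_s (v := v) (w := s v)); last exact: imset_f.
  by rewrite [RHS](mate_unique match_s (v := v)) // st; apply: imset_f.
apply: eq_card => M; rewrite inE; apply/idP/imsetP => [matchM|[s]]; last first.
  by rewrite inE => /andP[adj_s /eqP sV] ->; apply: perm_edges_matching.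
have /andP[/subsetP Medges _] := matchM.
have mateE := permE (inv_inj (mateK matchM)).
exists (perm (inv_inj (mateK matchM))).
  rewrite !inE; apply/andP; split.
    by apply/forallP=> v; rewrite mateE; apply/edges_set2/Medges/mate_edge.
  rewrite eq_invg_mul; apply/eqP/permP=> v.
  by rewrite permM !mateE mateK ?perm1.
apply/setP=> e; apply/idP/imsetP => [eM|[v _ ->]]; last first.
  by rewrite mateE mate_edge.
have /imsetP[[a b] _ /= e_ab] := Medges _ eM.
by exists a => //; rewrite mateE -(mate_unique matchM (w := b)) -?e_ab.
Qed.

End LampGame.

Theorem theorem6p1 (V : finType) (adj : rel V) (adj_sym : symmetric adj) :
  (forall S : {set V}, can_be_lit adj S) <->
  odd #|[set M : {set {set V}} | complete_matching adj M]|.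
Proof.
rewrite card_matchings // -odd_card_involution; first last.
(* Stability under inversion: with [u] the preimage of [v] under [s], [adj u (s u)] is [adj u v],
   which symmetry reverses. *)
- move=> s; rewrite !inE => /forallP adj_s; apply/forallP=> v.
  by rewrite adj_sym -{2}(permKV s v).
- exact: invgK.
apply: (iff_trans (all_lit_unitmx adj)).
rewrite unitmxE det_adjmx F2_natr_odd unitfE.
by case: odd.
Qed.
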